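(* Let $f_1,f_2:I\to\mathbb{R}$ be the components of the hidden variable recurrent fractal interpolation function with function contractivity factors $s_i,s_i',\tilde s_i,\tilde s_i'$, and let $f_1^*,f_2^*:I\to\mathbb{R}$ be the corresponding components when the factors are perturbed to $s_i+\delta_i,\ s_i'+\delta_i',\ \tilde s_i+\tilde\delta_i,\ \tilde s_i'+\tilde\delta_i'$ (all as defined in the context). If $\Omega+\Delta+\tilde\Omega+\tilde\Delta<1$, then there exist positive numbers $P,Q,\tilde P,\tilde Q$ such that for all $x\in I$ $$|f_1(x)-f_1^*(x)|\le\frac{P\Delta+Q\tilde\Delta}{1-(\Omega+\Delta)-(\tilde\Omega+\tilde\Delta)},\qquad |f_2(x)-f_2^*(x)|\le\frac{\tilde P\Delta+\tilde Q\tilde\Delta}{1-(\Omega+\Delta)-(\tilde\Omega+\tilde\Delta)}.$$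
   Context: Data: $0=x_0<x_1<\dots<x_n=1$, $I=[x_0,x_n]=[0,1]$, real numbers $y_0,\dots,y_n$ (given data) and $z_0,\dots,z_n$ (parameters). Regions: $I_i=[x_{i-1},x_i]$, $i=1,\dots,n$. Domains: for an integer $l$ with $2\le l\le n$, intervals $\tilde I_k=[x_{s(k)},x_{e(k)}]$, $k=1,\dots,l$, where $s(k),e(k)\in\{0,\dots,n\}$ and $e(k)-s(k)\ge2$. For each $i\in\{1,\dots,n\}$ an index $\gamma(i)\in\{1,\dots,l\}$ is chosen. For $k=\gamma(i)$, $L_{i,k}:\tilde I_k\to I_i$ is a contracting similitude (affine bijection) mapping the set of end points $\{x_{s(k)},x_{e(k)}\}$ onto $\{x_{i-1},x_i\}$. For each $i$, the function contractivity factors $s_i,s_i',\tilde s_i,\tilde s_i':I_i\to\mathbb{R}$ are Lipschitz functions with absolute value less than $1$, and the perturbations $\delta_i,\delta_i',\tilde\delta_i,\tilde\delta_i':I_i\to\mathbb{R}$ are Lipschitz functions. For a function $f$ write $\bar f=\max_x|f(x)|$ (maximum over its domain). Put $$\Omega=\max_k\{\bar s_k,\bar s_k'\},\quad \tilde\Omega=\max_k\{\bar{\tilde s}_k,\bar{\tilde s}_k'\},\quad \Delta=\max_k\{\bar\delta_k,\bar\delta_k'\},\quad \tilde\Delta=\max_k\{\bar{\tilde\delta}_k,\bar{\tilde\delta}_k'\},$$ the maxima being over $k=1,\dots,n$. Define (with $k=\gamma(i)$) the affine functions $$g_{i,k}(x)=\frac{x-x_{s(k)}}{x_{e(k)}-x_{s(k)}}y_{e(k)}+\frac{x-x_{e(k)}}{x_{s(k)}-x_{e(k)}}y_{s(k)},\qquad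 g_{i,k}'(x)=\frac{x-x_{s(k)}}{x_{e(k)}-x_{s(k)}}z_{e(k)}+\frac{x-x_{e(k)}}{x_{s(k)}-x_{e(k)}}z_{s(k)},$$ $$h_i(x)=\frac{x-x_{i-1}}{x_i-x_{i-1}}y_i+\frac{x-x_i}{x_{i-1}-x_i}y_{i-1},\qquad \tilde h_i(x)=\frac{x-x_{i-1}}{x_i-x_{i-1}}z_i+\frac{x-x_i}{x_{i-1}-x_i}z_{i-1}.$$ (The prime in $g'_{i,k}$, $s_i'$, $\delta_i'$ is only a label, not a derivative.) The pair $(f_1,f_2)$ is the unique continuous function $I\to\mathbb{R}^2$ with $f_1(x_i)=y_i$, $f_2(x_i)=z_i$ ($i=0,\dots,n$) satisfying, for every $i\in\{1,\dots,n\}$ and $x\in I_i$, with $x'=L_{i,\gamma(i)}^{-1}(x)$, $$f_1(x)=s_i(x)[f_1(x')-g_{i,\gamma(i)}(x')]+s_i'(x)[f_2(x')-g_{i,\gamma(i)}'(x')]+h_i(x),$$ $$f_2(x)=\tilde s_i(x)[f_1(x')-g_{i,\gamma(i)}(x')]+\tilde s_i'(x)[f_2(x')-g_{i,\gamma(i)}'(x')]+\tilde h_i(x).$$ The pair $(f_1^*,f_2^* )$ is the unique continuous function $I\to\mathbb{R}^2$ interpolating the same data and satisfying, for every $i$ and $x\in I_i$, with $x'=L_{i,\gamma(i)}^{-1}(x)$, $$f_1^*(x)=(s_i(x)+\delta_i(x))[f_1^*(x')-g_{i,\gamma(i)}(x')]+(s_i'(x)+\delta_i'(x))[f_2^*(x')-g_{i,\gamma(i)}'(x')]+h_i(x),$$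 $$f_2^*(x)=(\tilde s_i(x)+\tilde\delta_i(x))[f_1^*(x')-g_{i,\gamma(i)}(x')]+(\tilde s_i'(x)+\tilde\delta_i'(x))[f_2^*(x')-g_{i,\gamma(i)}'(x')]+\tilde h_i(x).$$ *)

(* Defs.v *)
From mathcomp Require Import all_boot all_order all_algebra.
From mathcomp Require Import all_classical all_reals all_analysis.

Set Implicit Arguments.
Unset Strict Implicit.
Unset Printing Implicit Defensive.

Import Order.TTheory GRing.Theory Num.Theory.
Import numFieldNormedType.Exports.

Local Open Scope classical_set_scope.
Local Open Scope ring_scope.

(* The n regions are indexed by i : 'I_n, i standing for i + 1 in 1-based      *)
(* numbering: region i is [x_i, x_(i+1)].                                      *)

Definition lnode (n : nat) (i : 'I_n) : 'I_n.+1 := widen_ord (leqnSn n) i.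
Definition rnode (n : nat) (i : 'I_n) : 'I_n.+1 := lift ord0 i.

Definition unit_partition (R : realType) (n : nat) (x : 'I_n.+1 -> R) : Prop :=
  [/\ x ord0 = 0, x ord_max = 1
    & forall i j : 'I_n.+1, (i < j)%N -> x i < x j].

Definition region (R : realType) (n : nat) (x : 'I_n.+1 -> R) (i : 'I_n) :
  set R := `[x (lnode i), x (rnode i)].

(* lo k and hi k are the indices s(k) and e(k) of the end points.              *)
Definition domain (R : realType) (n l : nat) (x : 'I_n.+1 -> R)
  (lo hi : 'I_l -> 'I_n.+1) (k : 'I_l) : set R := `[x (lo k), x (hi k)].

Definition contracting_similitude (R : realType) (A B : set R) (f : R -> R) :
  Prop :=
  exists a b : R, [/\ 0 < `|a|, `|a| < 1, forall t, A t -> f t = a * t + b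
                    & set_bij A B f].

(* A function on A is represented by a total function R -> R of which only the *)
(* values on A matter. On a nonempty compact A and for continuous f the        *)
(* supremum is attained, i.e. it is the maximum of |f| over A.                 *)
Definition max_abs (R : realType) (A : set R) (f : R -> R) : R :=
  sup [set `|f t| | t in A].

(* max_k {max |u_k|, max |v_k|}, the inner maxima being over the k-th region;  *)
(* all values are nonnegative, so 0 is a neutral starting value.               *)
Definition max_abs2 (R : realType) (n : nat) (x : 'I_n.+1 -> R)
  (u v : 'I_n -> R -> R) : R :=
  \big[Num.max/0]_(k < n)
    Num.max (max_abs (region x k) (u k)) (max_abs (region x k) (v k)).

Definition lipschitz_family (R : realType) (n : nat) (x : 'I_n.+1 -> R)
  (u : 'I_n -> R -> R) : Prop :=
  forall i : 'I_n, [lipschitz u i t | t in region x i].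

Definition contractivity_factors (R : realType) (n : nat) (x : 'I_n.+1 -> R)
  (u : 'I_n -> R -> R) : Prop :=
  lipschitz_family x u /\
  forall (i : 'I_n) (t : R), region x i t -> `|u i t| < 1.

(* The affine function through (x p, w p) and (x q, w q).                      *)
Definition chord (R : realType) (n : nat) (x w : 'I_n.+1 -> R) (p q : 'I_n.+1)
  (t : R) : R :=
  (t - x p) / (x q - x p) * w q + (t - x q) / (x p - x q) * w p.

(* (f1, f2) is the hidden variable recurrent fractal interpolation function    *)
(* with factors u, u' (first component) and v, v' (second component); L i is   *)
(* the map from the domain number gam i onto region i. The inverse image       *)
(* t' of t under L i is the point t' of that domain with L i t' = t.           *)
Definition hvrfif (R : realType) (n l : nat) (x y z : 'I_n.+1 -> R)
  (lo hi : 'I_l -> 'I_n.+1) (gam : 'I_n -> 'I_l) (L : 'I_n -> R -> R)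
  (u u' v v' : 'I_n -> R -> R) (f1 f2 : R -> R) : Prop :=
  [/\ {within `[0, 1], continuous f1},
      {within `[0, 1], continuous f2},
      forall i : 'I_n.+1, f1 (x i) = y i /\ f2 (x i) = z i
    & forall (i : 'I_n) (t t' : R),
        region x i t -> domain x lo hi (gam i) t' -> L i t' = t ->
        let g := chord x y (lo (gam i)) (hi (gam i)) in
        let g' := chord x z (lo (gam i)) (hi (gam i)) in
        f1 t = u i t * (f1 t' - g t') + u' i t * (f2 t' - g' t')
               + chord x y (lnode i) (rnode i) t
        /\
        f2 t = v i t * (f1 t' - g t') + v' i t * (f2 t' - g' t')
               + chord x z (lnode i) (rnode i) t].

(* Main.v *)
Require Import Defs.
From mathcomp Require Import all_boot all_order all_algebra.
From mathcomp Require Import all_classical all_reals all_analysis.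
From mathcomp Require Import ring lra.

Set Implicit Arguments.
Unset Strict Implicit.
Unset Printing Implicit Defensive.

Import Order.TTheory GRing.Theory Num.Theory.
Import numFieldNormedType.Exports.
Local Open Scope classical_set_scope.
Local Open Scope ring_scope.

(** Both pairs satisfy a fixed point equation of the same shape, so subtracting
    the two equations at a point t of a region, with preimage t', gives
      f1 t - f1s t = (s + d) (f1 - f1s)(t') + (s' + d') (f2 - f2s)(t')
                     - (d (f1 - g)(t') + d' (f2 - g')(t'))
    and similarly for the second components: the interpolation terms cancel,
    and the perturbations only multiply the unperturbed functions, which do
    not depend on them ([perturbation_step]).  With M a bound of |f1| and |f2|
    on [0, 1], each of |f1 - g| and |f2 - g'| is at most 2 M, because a chord
    of f1 or f2 stays between two of its values ([chord_le]).

    Let h := |f1 - f1s| + |f2 - f2s|.  Adding the estimates for the two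
    components gives
      h t <= (Om + De + tOm + tDe) h t' + 4 M (De + tDe).
    The regions cover [0, 1] ([region_cover]) and h, being continuous, attains
    its maximum there; at a maximum point t one has h t' <= h t, so that
    h <= 4 M (De + tDe) / (1 - (Om + De) - (tOm + tDe)).  Each of the two
    errors is at most h, hence 4 M serves for all four constants. *)

(** The bound M enters only through its existence: the supremum of an unbounded
    set has a default value, which need not be an upper bound. *)
Lemma max_abs_ge (R : realType) (A : set R) (f : R -> R) (M t : R) :
  (forall r, A r -> `|f r| <= M) -> A t -> `|f t| <= max_abs A f.
Proof.
move=> fM At; apply: ub_le_sup; last by exists t.
by exists M => _ [r Ar <-]; exact: fM.
Qed.

Lemma lipschitz_itv_bounded (R : realType) (a b : R) (f : R -> R) :
  [lipschitz f t | t in `[a, b]] ->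
  exists M, forall t, t \in `[a, b] -> `|f t| <= M.
Proof.
move=> [k0 [_ /(_ (`|k0| + 1))]].
(* Any constant above k0 is a Lipschitz constant; this one is nonnegative. *)
set k := `|k0| + 1 => lipf.
have k_ge0 : 0 <= k by rewrite addr_ge0.
have k0k : k0 < k by apply: le_lt_trans (ler_norm k0) _; rewrite ltrDl.
exists (`|f a| + k * (b - a)) => t; rewrite in_itv => /andP[/= at_ tb].
have aab : (`[a, b]%classic `*` `[a, b]%classic) (t, a).
  by split; rewrite /= in_itv /= ?lexx ?at_ ?tb ?(le_trans at_ tb).
have /= := lipf k0k (t, a) aab.
rewrite (ger0_norm (_ : 0 <= t - a)) ?subr_ge0// => lip.
have := ler_normD (f t - f a) (f a); rewrite subrK.
have : k * (t - a) <= k * (b - a) by rewrite ler_wpM2l// lerD2r.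
lra.
Qed.

Lemma lipschitz_le_max_abs2 (R : realType) (n : nat) (x : 'I_n.+1 -> R)
    (u v : 'I_n -> R -> R) (i : 'I_n) (t : R) :
  lipschitz_family x u -> lipschitz_family x v -> region x i t ->
  `|u i t| <= max_abs2 x u v /\ `|v i t| <= max_abs2 x u v.
Proof.
move=> /(_ i)/lipschitz_itv_bounded[M uM] /(_ i)/lipschitz_itv_bounded[N vN] it.
have le_i : Num.max (max_abs (region x i) (u i)) (max_abs (region x i) (v i))
    <= max_abs2 x u v.
  exact: (le_bigmax 0 (fun k : 'I_n =>
    Num.max (max_abs (region x k) (u k)) (max_abs (region x k) (v k)))).
split; apply: le_trans le_i; rewrite le_max.
  by rewrite (max_abs_ge (M := M)).
by rewrite (max_abs_ge (M := N)) ?orbT.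
Qed.

Lemma unit_partition_mem (R : realType) (n : nat) (x : 'I_n.+1 -> R)
    (p : 'I_n.+1) :
  unit_partition x -> 0 <= x p <= 1.
Proof.
move=> [x0 x1 xlt]; rewrite -x0 -x1.
have xle (i j : 'I_n.+1) : (i <= j)%N -> x i <= x j.
  rewrite leq_eqVlt => /predU1P[/val_inj-> //|/xlt/ltW //].
by rewrite !xle ?leq0n -1?ltnS.
Qed.

Lemma domain_sub_unit (R : realType) (n l : nat) (x : 'I_n.+1 -> R)
    (lo hi : 'I_l -> 'I_n.+1) (k : 'I_l) (t : R) :
  unit_partition x -> domain x lo hi k t -> 0 <= t <= 1.
Proof.
move=> hx; rewrite /domain /= in_itv /=.
have /andP[a0 _] := unit_partition_mem (lo k) hx.
have /andP[_ b1] := unit_partition_mem (hi k) hx.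
move=> /andP[at_ tb].
by rewrite (le_trans a0 at_) (le_trans tb b1).
Qed.

(** The region of t is the last one whose left end point is at most t. *)
Lemma region_cover (R : realType) (n : nat) (x : 'I_n.+1 -> R) (t : R) :
  (0 < n)%N -> unit_partition x -> 0 <= t <= 1 -> exists i, region x i t.
Proof.
case: n x => // n x _ [x0 x1 _] /andP[t0 t1].
have P0 : x (lnode (@ord0 n)) <= t.
  by rewrite (_ : lnode _ = ord0) ?x0//; exact: val_inj.
case: (@arg_maxnP 'I_n.+1 ord0 (fun i => x (lnode i) <= t) val P0) => i xi imax.
exists i; rewrite /region /= in_itv /= xi /=.
case: (ltnP i n) => [ltin|lein].
  have <- : lnode (Ordinal (ltin : (i.+1 < n.+1)%N)) = rnode i.
    exact: val_inj.
  rewrite leNgt; apply/negP => /ltW/imax /=.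
  by rewrite /= ltnn.
rewrite (_ : rnode i = ord_max) ?x1//; apply: val_inj => /=.
by apply/eqP; rewrite /bump add1n eqSS eqn_leq lein andbT -ltnS.
Qed.

(** On its own segment a chord is a convex combination of its end values. *)
Lemma chord_le (R : realType) (n : nat) (x w : 'I_n.+1 -> R) (p q : 'I_n.+1)
    (t M : R) :
  x p < x q -> x p <= t <= x q -> `|w p| <= M -> `|w q| <= M ->
  `|chord x w p q t| <= M.
Proof.
move=> pq /andP[pt tq] wp wq; rewrite /chord.
set a := (t - x p) / (x q - x p).
have -> : (t - x q) / (x p - x q) = 1 - a.
  by rewrite /a; field; rewrite !subr_eq0 (lt_eqF pq) (gt_eqF pq).
have a0 : 0 <= a by rewrite divr_ge0// subr_ge0// ltW.
have a1 : a <= 1 by rewrite ler_pdivrMr ?subr_gt0// mul1r lerD2r.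
clearbody a; apply: le_trans (ler_normD _ _) _.
rewrite !normrM (ger0_norm a0) (ger0_norm (_ : 0 <= 1 - a)) ?subr_ge0//.
have : a * `|w q| <= a * M by rewrite ler_wpM2l.
have : (1 - a) * `|w p| <= (1 - a) * M by rewrite ler_wpM2l// subr_ge0.
lra.
Qed.

Lemma norm_subr_chord_le (R : realType) (n l : nat) (x w : 'I_n.+1 -> R)
    (lo hi : 'I_l -> 'I_n.+1) (k : 'I_l) (f : R -> R) (t M : R) :
  unit_partition x -> (lo k < hi k)%N -> (forall i, f (x i) = w i) ->
  (forall r, 0 <= r <= 1 -> `|f r| <= M) -> domain x lo hi k t ->
  `|f t - chord x w (lo k) (hi k) t| <= 2 * M.
Proof.
move=> hx lohi fw fM kt.
have wM i : `|w i| <= M by rewrite -fw; exact/fM/unit_partition_mem.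
have : `|chord x w (lo k) (hi k) t| <= M.
  apply: chord_le => //; first by case: hx => _ _; apply.
have := fM _ (domain_sub_unit hx kt).
have := ler_normB (f t) (chord x w (lo k) (hi k) t).
lra.
Qed.

(** The right-hand side of the perturbed equation is expanded around the
    unperturbed values a and b, so that the perturbations e and e' multiply
    those, while a - a' and b - b' carry the perturbed factors. *)
Lemma perturbation_step (R : realType) (u u' e e' a b a' b' h O D : R) :
  `|u| <= O -> `|u'| <= O -> `|e| <= D -> `|e'| <= D ->
  `|(u * a + u' * b + h) - ((u + e) * a' + (u' + e') * b' + h)|
    <= (O + D) * (`|a - a'| + `|b - b'|) + D * (`|a| + `|b|).
Proof.
move=> uO uO' eD eD'.
have -> : (u * a + u' * b + h) - ((u + e) * a' + (u' + e') * b' + h)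
    = ((u + e) * (a - a') + (u' + e') * (b - b')) - (e * a + e' * b) by ring.
have factor_le v w : `|v| <= O -> `|w| <= D -> `|v + w| <= O + D.
  by move=> vO wD; apply: le_trans (ler_normD _ _) (lerD vO wD).
rewrite (mulrDr (O + D)) (mulrDr D); apply: le_trans (ler_normB _ _) _.
by apply: lerD; apply: le_trans (ler_normD _ _) _; rewrite !normrM;
  apply: lerD; apply: ler_wpM2r => //; exact: factor_le.
Qed.

Lemma within_continuous_norm (R : realType) (A : set R) (f : R -> R) :
  {within A, continuous f} -> {within A, continuous (fun t => `|f t|)}.
Proof.
move=> cf; apply: (@within_continuous_comp _ _ _ A f Num.norm) cf => r _.
exact: norm_continuous.
Qed.

Lemma within_unit_bounded (R : realType) (f : R -> R) :
  {within `[0, 1], continuous f} ->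
  exists M, forall t, 0 <= t <= 1 -> `|f t| <= M.
Proof.
move=> /within_continuous_norm/(EVT_max ler01)[c _ cmax].
by exists `|f c| => t t01; apply: cmax; rewrite in_itv.
Qed.

Theorem theorem3 (R : realType) (n l : nat) (x y z : 'I_n.+1 -> R)
  (lo hi : 'I_l -> 'I_n.+1) (gam : 'I_n -> 'I_l) (L : 'I_n -> R -> R)
  (s s' ts ts' d d' td td' : 'I_n -> R -> R) (f1 f2 f1s f2s : R -> R)
  (hl2 : (2 <= l)%N) (hln : (l <= n)%N)
  (hx : unit_partition x)
  (hdom : forall k : 'I_l, ((lo k).+2 <= hi k)%N)
  (hL : forall i : 'I_n,
    contracting_similitude (domain x lo hi (gam i)) (region x i) (L i))
  (hLend : forall i : 'I_n,
    L i @` [set x (lo (gam i)); x (hi (gam i))]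
      = [set x (lnode i); x (rnode i)])
  (hs : contractivity_factors x s) (hs' : contractivity_factors x s')
  (hts : contractivity_factors x ts) (hts' : contractivity_factors x ts')
  (hd : lipschitz_family x d) (hd' : lipschitz_family x d')
  (htd : lipschitz_family x td) (htd' : lipschitz_family x td')
  (hf : hvrfif x y z lo hi gam L s s' ts ts' f1 f2)
  (hfs : hvrfif x y z lo hi gam L
    (fun i => s i \+ d i) (fun i => s' i \+ d' i)
    (fun i => ts i \+ td i) (fun i => ts' i \+ td' i) f1s f2s) :
  let Om := max_abs2 x s s' in
  let tOm := max_abs2 x ts ts' in
  let De := max_abs2 x d d' in
  let tDe := max_abs2 x td td' in
  Om + De + tOm + tDe < 1 ->
  exists P Q tP tQ : R,
    [/\ 0 < P, 0 < Q, 0 < tP & 0 < tQ] /\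
    forall t : R, t \in `[0, 1] ->
      `|f1 t - f1s t| <= (P * De + Q * tDe) / (1 - (Om + De) - (tOm + tDe)) /\
      `|f2 t - f2s t| <= (tP * De + tQ * tDe) / (1 - (Om + De) - (tOm + tDe)).
Proof.
move=> Om tOm De tDe lt1.
have n0 : (0 < n)%N by exact: leq_trans (leq_trans _ hl2) hln.
have lohi k : (lo k < hi k)%N by exact: ltnW.
have [cf1 cf2 fx eqf] := hf; have [cf1s cf2s _ eqfs] := hfs.
have [M1 f1M] := within_unit_bounded cf1.
have [M2 f2M] := within_unit_bounded cf2.
pose M := `|M1| + `|M2| + 1.
have M_gt0 : 0 < M by rewrite ltr_wpDl ?addr_ge0.
have f1_le r : 0 <= r <= 1 -> `|f1 r| <= M.
  by move=> /f1M; have := ler_norm M1; have := normr_ge0 M2; rewrite /M; lra.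
have f2_le r : 0 <= r <= 1 -> `|f2 r| <= M.
  by move=> /f2M; have := ler_norm M2; have := normr_ge0 M1; rewrite /M; lra.
pose h t := `|f1 t - f1s t| + `|f2 t - f2s t|.
have ch : {within `[0, 1], continuous h}.
  apply: within_continuousD; apply: within_continuous_norm;
    exact: within_continuousB.
(* The inequality for h, t' being a preimage of t under the map of its region. *)
have step t : 0 <= t <= 1 -> exists2 t', 0 <= t' <= 1 &
    h t <= (Om + De + tOm + tDe) * h t' + 4 * M * (De + tDe).
  move=> t01; have [i it] := region_cover n0 hx t01.
  have [a [b [_ _ _ [_ _ /(_ t it)[t' dt' Lt']]]]] := hL i.
  exists t'; first exact: domain_sub_unit dt'.
  have [/= e1 e2] := eqf _ _ _ it dt' Lt'.
  have [/= e1s e2s] := eqfs _ _ _ it dt' Lt'.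
  have g1 := norm_subr_chord_le hx (lohi _) (fun i => proj1 (fx i)) f1_le dt'.
  have g2 := norm_subr_chord_le hx (lohi _) (fun i => proj2 (fx i)) f2_le dt'.
  have [sO sO'] := lipschitz_le_max_abs2 hs.1 hs'.1 it.
  have [tsO tsO'] := lipschitz_le_max_abs2 hts.1 hts'.1 it.
  have [dD dD'] := lipschitz_le_max_abs2 hd hd' it.
  have [tdD tdD'] := lipschitz_le_max_abs2 htd htd' it.
  rewrite /h {1}e1 {1}e1s {1}e2 {1}e2s.
  rewrite -/Om -/De -/tOm -/tDe in sO sO' tsO tsO' dD dD' tdD tdD' *.
  have De0 : 0 <= De := le_trans (normr_ge0 _) dD.
  have tDe0 : 0 <= tDe := le_trans (normr_ge0 _) tdD.
  set G1 := chord x y _ _ t' in g1 *; set G2 := chord x z _ _ t' in g2 *.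
  have cancel (c r r' : R) : (r - c) - (r' - c) = r - r' by ring.
  have G_le (D : R) : 0 <= D ->
      D * (`|f1 t' - G1| + `|f2 t' - G2|) <= D * (4 * M).
    by move=> D0; apply: ler_wpM2l => //; lra.
  have := perturbation_step (f1 t' - G1) (f2 t' - G2) (f1s t' - G1)
    (f2s t' - G2) (chord x y (lnode i) (rnode i) t) sO sO' dD dD'.
  have := perturbation_step (f1 t' - G1) (f2 t' - G2) (f1s t' - G1)
    (f2s t' - G2) (chord x z (lnode i) (rnode i) t) tsO tsO' tdD tdD'.
  rewrite !cancel.
  have := G_le _ De0; have := G_le _ tDe0; lra.
pose K := 1 - (Om + De) - (tOm + tDe).
have K_gt0 : 0 < K by rewrite /K; lra.
have h_le t : 0 <= t <= 1 -> h t <= 4 * M * (De + tDe) / K.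
  move=> t01; have [c c01 cmax] := EVT_max ler01 ch.
  apply: le_trans (cmax t _) _; first by rewrite in_itv.
  rewrite in_itv in c01; have [c' c'01 hc] := step c c01.
  have hc'c : h c' <= h c by apply: cmax; rewrite in_itv.
  rewrite ler_pdivlMr//.
  have h_ge0 r : 0 <= h r by rewrite addr_ge0.
  have S_ge0 : 0 <= Om + De + tOm + tDe.
    by rewrite !addr_ge0//; apply: bigmax_ge_id.
  have := ler_wpM2l S_ge0 hc'c; rewrite /K; lra.
have M4_gt0 : 0 < 4 * M by lra.
exists (4 * M), (4 * M), (4 * M), (4 * M); split=> // t.
rewrite in_itv => /h_le; rewrite -mulrDr -/K.
have := normr_ge0 (f1 t - f1s t); have := normr_ge0 (f2 t - f2s t).
by rewrite /h; split; lra.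
Qed.
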